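(* For every prime power $q$ and every integer $n \geq 1$, the domination number of $\Gamma_{l-i}(M_n(F_q))$ is $1$.
   Context: $F_q$ is the finite field with $q$ elements and $M_n(F_q)$ is the ring of all $n\times n$ matrices over $F_q$. For $X \in M_n(F_q)$, $[X] = \{AX : A \in M_n(F_q)\}$ is the left ideal generated by $X$. The undirected left-ideal relation graph $\Gamma_{l-i}(M_n(F_q))$ is the simple graph with vertex set $M_n(F_q)$ in which two distinct vertices $X, Y$ are adjacent if and only if $[X] \subset [Y]$ or $[Y] \subset [X]$, where $\subset$ denotes proper containment. A dominating set of a graph $\Gamma$ is a subset $D$ of $V(\Gamma)$ such that every vertex of $V(\Gamma)\setminus D$ is adjacent to at least one vertex of $D$; the domination number (also called dominance number) is the minimum size of a dominating set. *)

(* Defs.v *)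
From HB Require Import structures.
From mathcomp Require Import all_boot all_order all_algebra.
Set Implicit Arguments.
Unset Strict Implicit.
Unset Printing Implicit Defensive.

Import GRing.Theory.
Local Open Scope ring_scope.

(* A simple graph on the finite vertex type T is given by its adjacency
   relation e : rel T, assumed symmetric and irreflexive. *)

Definition dominating (T : finType) (e : rel T) (D : {set T}) : bool :=
  [forall y in ~: D, exists x in D, e y x].

Lemma dominating_setT (T : finType) (e : rel T) : dominating e [set: T].
Proof. by apply/forall_inP => y; rewrite !inE. Qed.

(* By dominating_setT the starting point of the arg min is always admissible. *)
Definition domination_number (T : finType) (e : rel T) : nat :=
  #|[arg min_(D < [set: T] | dominating e D) #|D|]|.

Lemma domination_numberP (T : finType) (e : rel T) :
  (exists2 D : {set T}, dominating e D & #|D| = domination_number e) /\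
  (forall D : {set T}, dominating e D -> (domination_number e <= #|D|)%N).
Proof.
rewrite /domination_number; case: arg_minnP => [|D domD minD].
  exact: dominating_setT.
by split=> //; exists D.
Qed.

Definition left_ideal (F : finFieldType) (n : nat) (X : 'M[F]_n) :
    {set 'M[F]_n} :=
  [set A *m X | A : 'M[F]_n].

Definition left_ideal_relation_graph (F : finFieldType) (n : nat) :
    rel 'M[F]_n :=
  fun X Y => (X != Y) &&
    ((left_ideal X \proper left_ideal Y) || (left_ideal Y \proper left_ideal X)).
Arguments left_ideal_relation_graph : clear implicits.

Lemma left_ideal_relation_graph_sym (F : finFieldType) (n : nat) :
  symmetric (left_ideal_relation_graph F n).
Proof. by move=> X Y; rewrite /left_ideal_relation_graph eq_sym orbC. Qed.

Lemma left_ideal_relation_graph_irr (F : finFieldType) (n : nat) :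
  irreflexive (left_ideal_relation_graph F n).
Proof. by move=> X; rewrite /left_ideal_relation_graph eqxx. Qed.

(* Main.v *)
(** The zero matrix generates the zero ideal, which is properly contained in
    every other principal left ideal, so [{0}] is a dominating set. *)
Require Import Defs.
From mathcomp Require Import all_boot all_order all_algebra.

(** The number is squeezed between two bounds: [dominating_zero] shows that one vertex, the zero
    matrix, suffices, and [dominating_card_gt0] that the empty set never does once a vertex
    exists. *)

Lemma left_ideal0 (F : finFieldType) (n : nat) :
  left_ideal (0 : 'M[F]_n)%R = [set 0%R].
Proof.
apply/setP=> Y; rewrite inE; apply/imsetP/eqP => [[A _ ->]|->].
  exact: mulmx0.
by exists 0%R; rewrite // mulmx0.
Qed.

Lemma mem_left_ideal (F : finFieldType) (n : nat) (X : 'M[F]_n) :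
  X \in left_ideal X.
Proof. by apply/imsetP; exists (1%:M)%R; rewrite // mul1mx. Qed.

Lemma left_ideal0_proper (F : finFieldType) (n : nat) (X : 'M[F]_n) :
  X != 0%R -> left_ideal (0 : 'M[F]_n)%R \proper left_ideal X.
Proof.
move=> X_neq0; rewrite left_ideal0; apply/properP; split.
  by rewrite sub1set; apply/imsetP; exists 0%R; rewrite // mul0mx.
by exists X; rewrite ?mem_left_ideal // inE.
Qed.

Lemma dominating_zero (F : finFieldType) (n : nat) :
  dominating (left_ideal_relation_graph F n) [set 0%R].
Proof.
apply/forall_inP=> Y; rewrite !inE => Y_neq0.
apply/exists_inP; exists 0%R; first by rewrite inE.
by rewrite /left_ideal_relation_graph Y_neq0 left_ideal0_proper // orbT.
Qed.

(** Either [x] lies in [D] or a neighbour of [x] does. The vertex [x] is required because the empty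
    set dominates the empty graph. *)
Lemma dominating_card_gt0 (T : finType) (e : rel T) (x : T) (D : {set T}) :
  dominating e D -> 0 < #|D|.
Proof.
move=> /forall_inP domD; rewrite card_gt0; apply/set0Pn.
have [xD|xnD] := boolP (x \in D); first by exists x.
by have /exists_inP[y yD _] : [exists y in D, e x y]
  := domD x ltac:(by rewrite inE); exists y.
Qed.

Theorem corollary4p5 (q p k : nat) (p_prime : prime p) (k_gt0 : 0 < k)
    (q_def : q = p ^ k) (F : finFieldType) (F_card : #|F| = q)
    (n : nat) (n_gt0 : 0 < n) :
  domination_number (left_ideal_relation_graph F n) = 1.
Proof.
have [[D domD cardD] minD] :=
  domination_numberP (left_ideal_relation_graph F n).
(* The lower bound is read off a minimum dominating set [D]; only the upper bound remains. *)
apply/eqP; rewrite eqn_leq -{2}cardD (dominating_card_gt0 _ _ 0%R _ domD) andbT.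
by rewrite -(cards1 (0 : 'M[F]_n)%R) minD // dominating_zero.
Qed.
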